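(* Let $G=(V,E)$ be a finite graph with $V\ne\emptyset$, let $\mathbf{k}$ be a field, and let $\pi,\pi'$ be ordered partitions of $V$ such that $\pi'$ is a coarsening of $\pi$. Let $d:V\to\mathbb{Z}$, $v\mapsto d_v$, be a function whose induced ordered partition is $\pi$, and let $x=(t^{-d_v})_{v\in V}$, with $t$ an indeterminate. Then $$\lim_{t\to0}x\cdot\mathcal{G}_{\pi'}=\mathcal{G}_\pi.$$ In particular, $\mathcal{G}_\pi=\mathcal{G}_{\pi'}(\pi)$, and so $\gamma_\pi$ is the splitting of $\gamma_{\pi'}$ with respect to $\pi$. As a consequence, $\gamma_\pi(I)\le\gamma_{\pi'}(I)$ for all $I\subseteq V$.
   Context: Graphs are finite; loops and multiple edges are allowed. $\mathbb{E}$ denotes the set of arrows of $G$: each edge $e=\{v,w\}$ gives two arrows $v\to w$ and $w\to v$ (a loop also gives two distinct arrows, corresponding to its two half-edges). If $a$ is an arrow $v\to w$, its tail is $v$, its head is $w$, and $\bar a$ denotes the reverse arrow on the same edge. For $v\in V$, $\mathbb{E}_v$ is the set of arrows with tail $v$. An ordered partition $\pi=(\pi_1,\dots,\pi_r)$ of $V$ is a partition of $V$ into nonempty parts together with a total order on the parts; its level function is $h:V\to[r]=\{1,\dots,r\}$, with $h(v)=n$ iff $v\in\pi_n$. An edge $\{u,v\}$ is vertical if $h(u)\ne h(v)$ and horizontal otherwise; an arrow is vertical or horizontal according to its edge. A vertical arrow $u\to v$ is upward if $h(u)>h(v)$ and downward if $h(u)<h(v)$. If $\pi'=(\pi'_1,\dots,\pi'_s)$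 has level function $h'$, then $\pi'$ is a coarsening of $\pi$ if $h'=c\circ h$ for some map $c:[r]\to[s]$ with $c(n_1)\le c(n_2)$ whenever $n_1\le n_2$. The ordered partition induced by $d:V\to\mathbb{Z}$ is the partition of $V$ into the nonempty level sets of $d$, ordered by increasing value of $d$. The $\pi$-residue space $\mathcal{G}_\pi$ is the subspace of all $\psi=(\psi_a)_{a\in\mathbb{E}}\in\Upsilon:=\mathbf{k}^{\mathbb{E}}$ satisfying: (R1) $\psi_a=0$ for every downward arrow $a$. (R2) $\sum_{a\in\mathbb{E}_v}\psi_a=0$ for every $v\in V$. (R3) $\psi_a+\psi_{\bar a}=0$ for every horizontal arrow $a$. (R4) For each $n\in[r]$ and each connected component $\Xi$ of the induced subgraph $G[\{v\in V: h(v)<n\}]$, $\sum_{a}\psi_a=0$, where the sum runs over all upward arrows $a$ with tail of level $n$ and head in $\Xi$. ($\mathcal{G}_{\pi'}$ is defined in the same way with $\pi'$ in place of $\pi$.) Write $\Upsilon=\bigoplus_{v\in V}\Upsilon_v$ with $\Upsilon_v=\mathbf{k}^{\mathbb{E}_v}$ and, for $I\subseteq V$, $\Upsilon_I=\bigoplus_{v\in I}\Upsilon_v$, with projection $\theta_I:\Upsilon\to\Upsilon_I$. Put $\gamma_\pi(I)=\dim_{\mathbf{k}}\theta_I(\mathcal{G}_\pi)$, a submodular function on $2^V$. Limit: with $R=\mathbf{k}[t,t^{-1}]$, $x$ acts on $\Upsilon\otimes_{\mathbf{k}}R$ by $(x\cdot\varphi)_a=t^{-d_v}\varphi_a$ for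 $v\in V$, $a\in\mathbb{E}_v$. For a subspace $W\subseteq\Upsilon$ of dimension $m$, $\lim_{t\to0}x\cdot W$ is the limit as $t\to0$ in the Grassmannian of $m$-dimensional subspaces of $\Upsilon$ of the family $x(t)\cdot W$, $t\neq 0$; that is, the value at $t=0$ of the unique extension to $\mathbb{A}^1$ of the corresponding morphism from $\mathbb{G}_m$ to the Grassmannian. Equivalently, it is the image in $\Upsilon$ under $t\mapsto0$ of $(x\cdot(W\otimes_{\mathbf{k}} R))\cap(\Upsilon\otimes_{\mathbf{k}}\mathbf{k}[t])$. Subspace $W(\pi)$: let $F_0=\emptyset$, $F_n=\pi_1\cup\dots\cup\pi_n$. For $I\subseteq V$ let $W^I=W\cap\Upsilon_I$ be the elements of $W$ with zero components outside $I$. Put $W_n=\theta_{\pi_n}(W^{F_n})\subseteq\Upsilon_{\pi_n}$ (so $W_n\cong W^{F_n}/W^{F_{n-1}}$) and $W(\pi)=\bigoplus_{n=1}^rW_n\subseteq\bigoplus_n\Upsilon_{\pi_n}=\Upsilon$. Splitting: for a function $\eta:2^V\to\mathbb{R}$ with $\eta(\emptyset)=0$, its adjoint is $\eta^*(I)=\eta(V)-\eta(V\setminus I)$; $\eta$ is submodular iff $\eta^*$ is supermodular. The splitting of a supermodular function $\mu$ with respect to $\pi$ is $$\mu_\pi(I)=\sum_{n=1}^r\bigl(\mu((I\cap F_n)\cup F_{n-1})-\mu(F_{n-1})\bigr).$$ The splitting of a submodular function $\eta$ with respect to $\pi$ is the adjoint of the splitting of the supermodular function $\eta^*$. *)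

(* Defs.v *)
From HB Require Import structures.
From mathcomp Require Import all_boot all_order all_algebra.

Set Implicit Arguments.
Unset Strict Implicit.
Unset Printing Implicit Defensive.

Import Order.TTheory GRing.Theory Num.Theory.
Local Open Scope ring_scope.

(* Multigraphs, loops allowed. [ends] lists the two ends of an edge in an
   arbitrary order. The arrow [(e, false)] goes from [(ends e).1] to
   [(ends e).2] and [(e, true)] is its reverse; they differ even if [e] is a
   loop. *)
Record mgraph := MGraph {
  vertex : finType;
  edge : finType;
  ends : edge -> vertex * vertex }.

Notation arrow G := (edge G * bool)%type.

Section Arrows.
Variable G : mgraph.

Definition tail (a : arrow G) : vertex G :=
  if a.2 then (ends a.1).2 else (ends a.1).1.
Definition head (a : arrow G) : vertex G :=
  if a.2 then (ends a.1).1 else (ends a.1).2.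
Definition bar (a : arrow G) : arrow G := (a.1, ~~ a.2).

Definition adj_in (S : {set vertex G}) : rel (vertex G) :=
  fun u v => [&& u \in S, v \in S & [exists a, (tail a == u) && (head a == v)]].

Definition components (S : {set vertex G}) : {set {set vertex G}} :=
  equivalence_partition (connect (adj_in S)) S.

End Arrows.

Record opart (V : finType) := OPart {
  parts : seq {set V};
  parts_uniq : uniq parts;
  parts_partition : partition [set:: parts] [set: V] }.

Section OrderedPartitions.
Variable V : finType.
Implicit Types (p : opart V) (d : V -> int).

Lemma level_proof p v :
  (find (fun B : {set V} => v \in B) (parts p) < size (parts p))%N.
Proof.
rewrite -has_find; have: v \in cover [set:: parts p].
  by rewrite (cover_partition (parts_partition p)) inE.
by case/bigcupP=> B; rewrite inE => Bp vB; apply/hasP; exists B.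
Qed.

(* Levels are numbered from 0: [level p v] is h(v) - 1. *)
Definition level p v : 'I_(size (parts p)) := Ordinal (level_proof p v).

Definition part p (n : nat) : {set V} := nth set0 (parts p) n.

Definition initial p (n : nat) : {set V} := \bigcup_(B <- take n (parts p)) B.

Lemma mem_part p v (n : 'I_(size (parts p))) :
  (v \in part p n) = (level p v == n).
Proof.
have hv : v \in part p (level p v).
  have := level_proof p v; rewrite -has_find => h.
  exact: (@nth_find _ set0 (fun B : {set V} => v \in B) _ h).
apply/idP/eqP => [vn|<-//]; apply: val_inj => /=.
have /trivIsetP tI := partition_trivIset (parts_partition p).
have [//|ne] := eqVneq (val (level p v)) n.
have m1 : part p (level p v) \in [set:: parts p] by rewrite inE mem_nth.
have m2 : part p n \in [set:: parts p] by rewrite inE mem_nth.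
have neB : part p (level p v) != part p n.
  by rewrite nth_uniq ?parts_uniq.
have := tI _ _ m1 m2 neB.
by rewrite disjoint_subset => /subsetP /(_ v hv); rewrite inE vn.
Qed.

Lemma mem_initial p v n : (v \in initial p n) = (level p v < n)%N.
Proof.
rewrite /initial bigcup_seq; apply/bigcupP/idP => [[B Bt vB]|lt].
  have lts : (index B (parts p) < size (parts p))%N.
    by rewrite index_mem; exact: mem_take Bt.
  have vi : v \in part p (Ordinal lts) by rewrite /part /= nth_index ?(mem_take Bt).
  have /eqP -> : level p v == Ordinal lts by rewrite -mem_part.
  by rewrite /= index_ltn.
exists (part p (level p v)); last by rewrite mem_part.
by rewrite /part -(nth_take _ lt) mem_nth // size_take_min leq_min lt ltn_ord.
Qed.

Definition coarsening p' p :=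
  exists c : 'I_(size (parts p)) -> 'I_(size (parts p')),
    (forall m n : 'I_(size (parts p)), (m <= n)%N -> (c m <= c n)%N) /\
    (forall v, level p' v = c (level p v)).

Definition level_sets d : seq {set V} :=
  [seq [set v | d v == z] | z <- sort <=%O (undup (codom d))].

Lemma level_sets_uniq d : uniq (level_sets d).
Proof.
rewrite map_inj_in_uniq ?sort_uniq ?undup_uniq // => x y.
rewrite !mem_sort !mem_undup => /codomP[v ->] _ /setP /(_ v).
by rewrite !inE eqxx => /esym /eqP.
Qed.

Lemma level_sets_partition d : partition [set:: level_sets d] [set: V].
Proof.
apply/and3P; split.
- rewrite eqEsubset subsetT; apply/subsetP => v _; apply/bigcupP.
  exists [set w | d w == d v]; last by rewrite inE.
  by rewrite inE; apply: map_f; rewrite mem_sort mem_undup codom_f.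
- apply/trivIsetP => A B; rewrite !inE => /mapP[x _ ->] /mapP[y _ ->] neq.
  rewrite disjoint_subset; apply/subsetP => v; rewrite !inE => /eqP dv.
  by apply: contraNneq neq => dv'; rewrite -dv -dv'.
- rewrite inE; apply/mapP => -[z]; rewrite mem_sort mem_undup.
  by case/codomP=> v -> /setP /(_ v); rewrite !inE eqxx.
Qed.

Definition induced_opart d : opart V :=
  OPart (level_sets_uniq d) (level_sets_partition d).

End OrderedPartitions.

Notation Upsilon k G := {ffun arrow G -> k^o}.

Section Coordinates.
Variables (k : fieldType) (G : mgraph).
Implicit Types (a : arrow G) (I : {set vertex G}) (psi : Upsilon k G).

Definition coord_fun a psi : k^o := psi a.

Fact coord_fun_linear a : linear (coord_fun a).
Proof. by move=> c u v; rewrite /coord_fun !ffunE. Qed.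
HB.instance Definition _ a :=
  GRing.isLinear.Build k (Upsilon k G) k^o _ (coord_fun a) (coord_fun_linear a).

Definition ev a : 'Hom(Upsilon k G, k^o) := linfun (coord_fun a).

Definition restrict I psi : Upsilon k G :=
  [ffun a => if tail a \in I then psi a else 0].

Fact restrict_linear I : linear (restrict I).
Proof.
move=> c u v; apply/ffunP => a; rewrite !ffunE.
by case: ifP; rewrite // scaler0 addr0.
Qed.
HB.instance Definition _ I :=
  GRing.isLinear.Build k (Upsilon k G) (Upsilon k G) _ (restrict I)
    (restrict_linear I).

(* Upsilon_I is realized inside Upsilon, by extending vectors by zero. *)
Definition theta I : 'End(Upsilon k G) := linfun (restrict I).
Definition UpsilonI I : {vspace Upsilon k G} := limg (theta I).

Lemma memUpsilonI I psi :
  reflect (forall a, tail a \notin I -> psi a = 0) (psi \in UpsilonI I).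
Proof.
apply: (iffP idP) => [/memv_imgP[phi _ ->] a /negPf aI | psi0].
  by rewrite lfunE ffunE aI.
apply/memv_imgP; exists psi; rewrite ?memvf // lfunE.
by apply/ffunP => a; rewrite ffunE; case: ifPn => // /psi0.
Qed.

End Coordinates.

Section ResidueSpace.
Variables (k : fieldType) (G : mgraph) (p : opart (vertex G)).
Local Notation h := (level p).
Local Notation ev := (@ev k G).

Definition upward (a : arrow G) := (h (head a) < h (tail a))%N.
Definition downward (a : arrow G) := (h (tail a) < h (head a))%N.
Definition horizontal (a : arrow G) := h (tail a) == h (head a).

Definition residue_space : {vspace Upsilon k G} :=
  ((\bigcap_(a | downward a) lker (ev a))
   :&: (\bigcap_v lker (\sum_(a | tail a == v) ev a)%R)
   :&: (\bigcap_(a | horizontal a) lker (ev a + ev (bar a))%R)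
   :&: \bigcap_(n < size (parts p))
         \bigcap_(Xi in components [set v | (h v < n)%N])
           lker (\sum_(a | [&& upward a, h (tail a) == n & head a \in Xi])
                   ev a)%R)%VS.

Lemma mem_bigcapv (J : finType) (P : pred J) (U : J -> {vspace Upsilon k G})
    (psi : Upsilon k G) :
  psi \in (\bigcap_(j | P j) U j)%VS <-> (forall j, P j -> psi \in U j).
Proof.
split=> [psiU j Pj | psiU].
  by move: psiU; rewrite (bigD1 j) //= memv_cap => /andP[].
by elim/big_ind: _ => [|A B hA hB|j /psiU //]; rewrite ?memvf // memv_cap hA.
Qed.

Lemma mem_residue_space (psi : Upsilon k G) :
  psi \in residue_space <->
  [/\ forall a, downward a -> psi a = 0,
      forall v, \sum_(a | tail a == v) psi a = 0,
      forall a, horizontal a -> psi a + psi (bar a) = 0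
    & forall (n : 'I_(size (parts p))) (Xi : {set vertex G}),
        Xi \in components [set v | (h v < n)%N] ->
        \sum_(a | [&& upward a, h (tail a) == n & head a \in Xi]) psi a = 0].
Proof.
have evE a : ev a psi = psi a by rewrite lfunE.
have sumE (P : pred (arrow G)) :
    (\sum_(a | P a) ev a) psi = \sum_(a | P a) psi a.
  by rewrite sum_lfunE; apply: eq_bigr.
rewrite /residue_space !memv_cap; split.
  case/andP=> /andP[/andP[]].
  move=> /mem_bigcapv h1 /mem_bigcapv h2 /mem_bigcapv h3 /mem_bigcapv h4.
  split=> [a /h1|v|a /h3|n Xi XiP].
  - by rewrite memv_ker evE => /eqP.
  - by have:= h2 v isT; rewrite memv_ker sumE => /eqP.
  - by rewrite memv_ker lfunE /= !evE => /eqP.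
  - have /mem_bigcapv/(_ _ XiP) := h4 n isT.
    by rewrite memv_ker sumE => /eqP.
case=> h1 h2 h3 h4; rewrite -!andbA; apply/and4P; split; apply/mem_bigcapv.
- by move=> a /h1 e; rewrite memv_ker evE e.
- by move=> v _; rewrite memv_ker sumE h2.
- by move=> a /h3 e; rewrite memv_ker lfunE /= !evE e.
- move=> n _; apply/mem_bigcapv => Xi XiP.
  by rewrite memv_ker sumE h4.
Qed.

Definition gamma (I : {set vertex G}) : int :=
  (\dim (theta k I @: residue_space)%VS)%:Z.

End ResidueSpace.

Section InitialSpace.
Variables (k : fieldType) (G : mgraph).

Definition supported_sub (W : {vspace Upsilon k G}) (I : {set vertex G}) :=
  (W :&: UpsilonI k I)%VS.

(* W(pi). With levels numbered from 0, the part of index n is pi_(n+1) and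
   [initial p n.+1] is F_(n+1). *)
Definition initial_space (p : opart (vertex G)) (W : {vspace Upsilon k G}) :
    {vspace Upsilon k G} :=
  (\sum_(n < size (parts p))
     theta k (part p n) @: supported_sub W (initial p n.+1))%VS.

End InitialSpace.

Section Splittings.
Variables (V : finType) (M : zmodType).
Implicit Types (p : opart V) (eta mu : {set V} -> M).

Definition adjoint eta : {set V} -> M :=
  fun I => eta [set: V] - eta (~: I).

Definition splitting_super p mu : {set V} -> M :=
  fun I => \sum_(n < size (parts p))
    (mu ((I :&: initial p n.+1) :|: initial p n) - mu (initial p n)).

Definition splitting_sub p eta : {set V} -> M :=
  adjoint (splitting_super p (adjoint eta)).

End Splittings.

(* A morphism from Spec A to the Grassmannian of Upsilon is a direct summand of
   the A-module Upsilon (x) A. All modules below live in Upsilon (x) k(t), with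
   R = k[t, t^-1] seen as a subring of k(t). *)
Section Limits.
Variables (k : fieldType) (G : mgraph).

Local Notation "x %:F" := (@FracField.tofrac _ x).
Local Notation kt := {fraction {poly k}}.
Local Notation UpsilonF := {ffun arrow G -> kt}.
Local Notation UpsilonP := {ffun arrow G -> {poly k}}.

Definition tvar : kt := ('X : {poly k})%:F.

Definition laurent (q : kt) : Prop :=
  exists (f : {poly k}) (n : nat), q = f%:F / tvar ^+ n.

Definition poly_embed (f : UpsilonP) : UpsilonF := [ffun a => (f a)%:F].
Definition const_embed (w : Upsilon k G) : UpsilonF := [ffun a => (w a)%:P%:F].

Definition at0 (f : UpsilonP) : Upsilon k G := [ffun a => (f a).[0]].

(* The R-submodule of Upsilon (x) R generated by S. *)
Definition Rspan (S : UpsilonF -> Prop) (phi : UpsilonF) : Prop :=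
  exists s : seq (kt * UpsilonF),
    (forall c, c \in s -> laurent c.1 /\ S c.2) /\
    (forall a, phi a = \sum_(c <- s) c.1 * c.2 a).

(* W (x) R *)
Definition extend_scalars (W : {vspace Upsilon k G}) : UpsilonF -> Prop :=
  Rspan (fun phi => exists2 w, w \in W & phi = const_embed w).

Definition act (d : vertex G -> int) (phi : UpsilonF) : UpsilonF :=
  [ffun a => tvar ^ (- d (tail a)) * phi a].

(* x . (W (x) R): the morphism from G_m given by t |-> x(t) . W *)
Definition family (d : vertex G -> int) (W : {vspace Upsilon k G})
    (psi : UpsilonF) : Prop :=
  exists2 phi, extend_scalars W phi & psi = act d phi.

Definition poly_submodule (L : UpsilonP -> Prop) : Prop :=
  [/\ L 0, forall f g, L f -> L g -> L (f + g)
    & forall (c : {poly k}) f, L f -> L [ffun a => c * f a]].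

Definition direct_summand (L : UpsilonP -> Prop) : Prop :=
  poly_submodule L /\
  exists L', [/\ poly_submodule L',
    forall f, exists g g', [/\ L g, L' g' & f = g + g']
    & forall f, L f -> L' f -> f = 0].

(* L extends the family to a morphism from A^1, whose value at 0 is U. *)
Definition is_limit (d : vertex G -> int) (W U : {vspace Upsilon k G}) : Prop :=
  exists L : UpsilonP -> Prop,
    [/\ direct_summand L,
        forall phi, Rspan (fun chi => exists2 f, L f & chi = poly_embed f) phi
                    <-> family d W phi
      & forall u, u \in U <-> exists2 f, L f & u = at0 f].

Lemma tvar_neq0 : tvar != 0.
Proof. by rewrite tofrac_eq0 polyX_eq0. Qed.

Lemma Rspan_clear_denominators (L : UpsilonP -> Prop) (f : UpsilonP) :
  poly_submodule L ->
  Rspan (fun chi => exists2 g, L g & chi = poly_embed g) (poly_embed f) ->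
  exists n, L [ffun a => 'X^n * f a].
Proof.
case=> L0 LD LM [s [sP fE]].
suff [n [g [Lg gE]]] : exists n (g : UpsilonP), L g /\
    forall a, tvar ^+ n * \sum_(c <- s) c.1 * c.2 a = (g a)%:F.
  exists n; suff -> : [ffun a => 'X^n * f a] = g by [].
  apply/ffunP => a; apply/eqP; rewrite ffunE -tofrac_eq -gE -fE ffunE.
  by rewrite tofracM tofracXn.
elim: s sP {fE} => [_|c s IH sP].
  by exists 0%N, 0; split=> // a; rewrite big_nil mulr0 ffunE tofrac0.
have [|n [g [Lg gE]]] := IH.
  by move=> c' c's; apply: sP; rewrite inE c's orbT.
have [[q [m qE]] [g' Lg' g'E]] := sP c (mem_head _ _).
exists (n + m)%N.
exists ([ffun a => 'X^m * g a] + [ffun a => ('X^n * q) * g' a]).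
split=> [|a]; first by apply: (LD); apply: (LM).
rewrite big_cons g'E qE !ffunE tofracD !tofracM !tofracXn -gE mulrDr addrC.
congr (_ + _); first by rewrite mulrA [tvar ^+ m * _]mulrC exprD.
rewrite exprD -!mulrA; congr (_ * _).
by rewrite mulrCA [tvar ^+ m * _]mulrA divff ?mul1r ?expf_neq0 ?tvar_neq0.
Qed.

Lemma mem_is_limit d W U (u : Upsilon k G) : is_limit d W U ->
  u \in U <-> exists2 f, family d W (poly_embed f) & u = at0 f.
Proof.
case=> L [[Lsub [L' [L'sub LL' L0]]] LW UE].
have [_ LD LM] := Lsub; have [_ _ L'M] := L'sub.
apply: (iff_trans (UE u)); split=> -[f fP ->]; exists f => //.
  apply/LW; exists [:: (1, poly_embed f)]; split=> [c|a]; last first.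
    by rewrite big_seq1 mul1r.
  rewrite inE => /eqP -> /=; split; last by exists f.
  by exists 1, 0%N; rewrite expr0 divr1 tofrac1.
have [n Lnf] := Rspan_clear_denominators Lsub (proj2 (LW _) fP).
have [g [g' [Lg L'g' fE]]] := LL' f.
suff g'0 : g' = 0 by rewrite fE g'0 addr0.
have Lng' : L [ffun a => 'X^n * g' a].
  have -> : [ffun a => 'X^n * g' a]
      = [ffun a => 'X^n * f a] + [ffun a => (- 'X^n) * g a] :> UpsilonP.
    by apply/ffunP => a; rewrite fE !ffunE mulrDr mulNr addrAC subrr add0r.
  by apply: (LD) => //; apply: (LM).
have := L0 _ Lng' (L'M _ _ L'g') => /ffunP e; apply/ffunP => a.
have /eqP := e a; rewrite !ffunE mulf_eq0 expf_eq0 polyX_eq0 andbF.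
by move/eqP.
Qed.

Lemma is_limit_uniq d W U1 U2 : is_limit d W U1 -> is_limit d W U2 -> U1 = U2.
Proof.
move=> l1 l2; apply/vspaceP => u; apply/idP/idP.
  by move/(mem_is_limit u l1)/(mem_is_limit u l2).
by move/(mem_is_limit u l2)/(mem_is_limit u l1).
Qed.

End Limits.

(* Main.v *)
From mathcomp Require Import all_boot all_order all_algebra.
Require Import Defs.

(** Call a function on the arrows a circulation if it is skew (opposite values
    on the two arrows of each edge) and its outflow at every vertex vanishes,
    and let Z be the space of circulations.  The theorem follows from one fact
    about graphs and three facts of linear algebra.

    The graph fact is that the residue space of every ordered partition p is
    the initial space Z(p) ([residue_spaceE]).  Restrict a circulation z that
    is supported on the levels up to n to its top level n.  The restriction
    has sum zero on the arrows into any component Xi of the lower levels, because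
    the outflow of z from Xi is zero and z can leave Xi only towards level n.
    Conversely, the level n part of an element of the residue space is a flow
    that sends zero in total into each component of the lower levels.  In a
    connected graph every demand function of total zero is met by some flow
    ([flow_exists]), so this part can be completed below level n to a
    circulation.

    Initial spaces are transitive, W(p')(p) = W(p) when p' is coarser than p
    ([initial_space_trans]), since both sides are computed from the
    elements of W supported on lower levels of p.  With W = Z, the residue
    space of p is the initial space of that of p'.

    The limit of x.W is W(p) for every subspace W ([is_limit_initial_space]).
    Choose a projector P onto W that maps the functions supported up to level n
    to themselves, for every n ([adapted_projector]).  In the conjugate
    x P x^-1 the entry from arrow b to arrow a is multiplied by
    t ^ (d (tail b) - d (tail a)), and the entry vanishes whenever the exponent
    is negative.  Hence x P x^-1 is an idempotent matrix of polynomials: its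
    image is a direct summand, which extends the family, and at t = 0 only the
    entries within a level remain, which cut out W(p).

    Finally theta_I maps W(p) to a direct sum over the levels, whose summands
    have dimensions given by rank-nullity ([dim_theta_initial_splitting]).
    Taking all vertices for I gives dim W(p) = dim W; and since theta_I (W(p))
    is contained in (theta_I W)(p), this yields the inequality. *)

Set Implicit Arguments.
Unset Strict Implicit.
Unset Printing Implicit Defensive.

Import Order.TTheory GRing.Theory Num.Theory.
Local Open Scope ring_scope.

(** * Arrows, circulations and fluxes *)

Section Flows.
Variables (k : fieldType) (G : mgraph).
Implicit Types (a : arrow G) (X Y S C : {set vertex G}) (psi f : Upsilon k G).

Lemma barK : involutive (@bar G).
Proof. by case=> e b; rewrite /bar negbK. Qed.
Lemma tail_bar a : tail (bar a) = head a.
Proof. by case: a => e []. Qed.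
Lemma head_bar a : head (bar a) = tail a.
Proof. by case: a => e []. Qed.

Definition skew psi := forall a, psi a + psi (bar a) = 0.

Definition circulation psi :=
  skew psi /\
  (forall v, \sum_(a | tail a == v) psi a = 0).

Definition circulation_space : {vspace Upsilon k G} :=
  ((\bigcap_a lker (ev k a + ev k (bar a))%R)
   :&: \bigcap_v lker (\sum_(a | tail a == v) ev k a)%R)%VS.

Lemma mem_circulation_space psi :
  psi \in circulation_space <-> circulation psi.
Proof.
rewrite memv_cap /circulation; split=> [/andP[/mem_bigcapv h1 /mem_bigcapv h2]|[h1 h2]].
  split=> [a|v].
    by have := h1 a isT; rewrite memv_ker lfunE /= !lfunE => /eqP.
  have := h2 v isT; rewrite memv_ker sum_lfunE => /eqP e.
  by apply: etrans e; apply: eq_bigr => a _; rewrite lfunE.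
apply/andP; split; apply/mem_bigcapv.
  by move=> a _; rewrite memv_ker lfunE /= !lfunE /= /coord_fun h1.
move=> v _; rewrite memv_ker sum_lfunE; apply/eqP; apply: etrans (h2 v).
by apply: eq_bigr => a _; rewrite lfunE.
Qed.

Definition flux psi X Y := \sum_(a | (tail a \in X) && (head a \in Y)) psi a.

Lemma flux_partition psi X Y (A : {set vertex G}) :
  flux psi X Y = flux psi X (Y :&: A) + flux psi X (Y :\: A).
Proof.
rewrite /flux (bigID (fun a => head a \in A)) /=; congr (_ + _);
  by apply: eq_bigl => a; rewrite !inE andbA // andbAC -andbA.
Qed.

Lemma flux_bar psi X Y : skew psi ->
  flux psi X Y = - flux psi Y X.
Proof.
move=> anti; rewrite /flux (reindex_inj (inv_inj barK)) /= -sumrN.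
apply: eq_big => [a|a _]; first by rewrite tail_bar head_bar andbC.
by apply/eqP; rewrite -addr_eq0 addrC anti.
Qed.

(** Cancelling the two arrows of each edge, rather than deducing that the flux
    equals its own opposite, keeps this true in characteristic 2. *)
Lemma flux_self psi X : skew psi -> flux psi X X = 0.
Proof.
move=> anti; rewrite /flux big_mkcond.
transitivity (\sum_(e : edge G) \sum_(b : bool)
    if (tail (e, b) \in X) && (head (e, b) \in X) then psi (e, b) else 0).
  by rewrite pair_bigA /=; apply: eq_bigr => -[].
apply: big1 => e _; rewrite big_bool -[(e, true)]/(bar (e, false)).
rewrite tail_bar head_bar [(head _ \in X) && _]andbC.
case: ifP => _ /=; last by rewrite addr0.
by rewrite addrC anti.
Qed.

Lemma flux_out psi X : (forall v, \sum_(a | tail a == v) psi a = 0) ->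
  flux psi X [set: vertex G] = 0.
Proof.
move=> div; rewrite /flux (partition_big (@tail G) (fun v => v \in X)) /=;
  last by move=> a /andP[].
rewrite big1 // => v vX; apply: etrans (div v); apply: eq_bigl => a.
by rewrite inE andbT andbC; case: eqP => // ->.
Qed.

Lemma flux_eq0 psi X Y :
  (forall a, tail a \in X -> head a \in Y -> psi a = 0) -> flux psi X Y = 0.
Proof. by move=> h; rewrite /flux big1 // => a /andP[]; apply: h. Qed.

Lemma adj_in_sym S : symmetric (adj_in S).
Proof.
move=> u v; rewrite /adj_in andbA [(u \in S) && _]andbC -andbA.
suff sub x y : [exists a : arrow G, (tail a == x) && (head a == y)]
    -> [exists a : arrow G, (tail a == y) && (head a == x)].
  rewrite (_ : [exists a, _] = [exists a : arrow G, (tail a == v) && (head a == u)]) //.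
  by apply/idP/idP; apply: sub.
case/existsP=> a /andP[/eqP <- /eqP <-]; apply/existsP; exists (bar a).
by rewrite tail_bar head_bar !eqxx.
Qed.

Lemma connect_adj_sym S : connect_sym (adj_in S).
Proof. exact/sym_connect_sym/adj_in_sym. Qed.

Lemma componentP S (C : {set vertex G}) :
  reflect (exists2 x, x \in S & C = [set y in S | connect (adj_in S) x y])
    (C \in components S).
Proof. by apply: (iffP imsetP) => -[x xS ->]; exists x. Qed.

Lemma component_sub S C : C \in components S -> C \subset S.
Proof. by case/componentP=> x xS ->; apply/subsetP => y; rewrite inE => /andP[]. Qed.

Lemma component_closed S C a : C \in components S ->
  tail a \in C -> head a \in S -> head a \in C.
Proof.
case/componentP=> x xS ->; rewrite !inE => /andP[tS ct] hS; rewrite hS /=.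
apply: connect_trans ct (connect1 _); rewrite /adj_in tS hS.
by apply/existsP; exists a; rewrite !eqxx.
Qed.

(** * Flows with prescribed outflow *)

(** The unit flow along [a]. *)
Definition dipole a : Upsilon k G := [ffun b => (b == a)%:R - (b == bar a)%:R].

Definition flow_in S psi :=
  skew psi /\
  (forall a, psi a != 0 -> tail a \in S /\ head a \in S).

Definition outflow psi v := \sum_(a | tail a == v) psi a.

Lemma flow_inD S f g : flow_in S f -> flow_in S g -> flow_in S (f + g).
Proof.
move=> [af sf] [ag sg]; split=> a; rewrite !ffunE.
  by rewrite addrACA af ag addr0.
have [->|/sf //] := eqVneq (f a) 0; rewrite add0r; exact: sg.
Qed.

Lemma flow_inZ S c f : flow_in S f -> flow_in S (c *: f).
Proof.
move=> [af sf]; split=> a; rewrite !ffunE; first by rewrite -scalerDr af scaler0.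
by rewrite mulf_eq0 negb_or => /andP[_ /sf].
Qed.

Lemma flow_in0 S : flow_in S 0.
Proof. by split=> a; rewrite !ffunE ?addr0 ?eqxx. Qed.

Lemma outflowD f g v : outflow (f + g) v = outflow f v + outflow g v.
Proof. by rewrite /outflow -big_split; apply: eq_bigr => a _; rewrite ffunE. Qed.

Lemma outflowZ c f v : outflow (c *: f) v = c * outflow f v.
Proof. by rewrite /outflow mulr_sumr; apply: eq_bigr => a _; rewrite ffunE. Qed.

Lemma outflow0 v : outflow 0 v = 0.
Proof. by apply: big1 => a _; rewrite ffunE. Qed.

Lemma outflow_dipole a v :
  outflow (dipole a) v = (v == tail a)%:R - (v == head a)%:R.
Proof.
have one b : \sum_(c : arrow G | tail c == v) (c == b)%:R = (v == tail b)%:R :> k.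
  have [->|nb] := eqVneq v (tail b).
    by rewrite (bigD1 b) //= eqxx big1 ?addr0 // => c /andP[_ /negPf ->].
  rewrite big1 // => c /eqP tc; case: eqP => // cb; move: nb.
  by rewrite -tc cb eqxx.
under [LHS]eq_bigr do rewrite ffunE.
by rewrite sumrB !one tail_bar.
Qed.

Lemma flow_in_dipole S a : tail a \in S -> head a \in S -> flow_in S (dipole a).
Proof.
move=> tS hS; split=> b; rewrite !ffunE.
  by rewrite (inv_eq barK) (inj_eq (inv_inj barK)) subrKA subrr.
case: (b =P a) => [->|_] //; case: (b =P bar a) => [->|_].
  by rewrite tail_bar head_bar.
by rewrite subr0 eqxx.
Qed.

Lemma path_flow S u w : u \in S -> connect (adj_in S) u w ->
  exists2 f, flow_in S f & forall v, outflow f v = (v == u)%:R - (v == w)%:R.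
Proof.
move=> uS /connectP[s]; elim: s u uS => [|x s IH] u uS /=.
  by move=> _ ->; exists 0 => [|v]; [exact: flow_in0 | rewrite outflow0 subrr].
case/andP=> /and3P[_ xS /existsP[a /andP[/eqP ta /eqP ha]]] p e.
have [f fS fE] := IH x xS p e.
exists (dipole a + f) => [|v].
  by apply: flow_inD => //; apply: flow_in_dipole; rewrite ?ta ?ha.
by rewrite outflowD outflow_dipole fE ta ha subrKA.
Qed.

(** A demand of total zero on every component of the graph induced on [S] is the
    sum, over the vertices [v], of [g v] times the difference between [v] and
    the root of its component; a path inside [S] realizes each difference. *)
Lemma flow_exists S (g : vertex G -> k) :
  (forall C, C \in components S -> \sum_(v in C) g v = 0) ->
  exists2 f, flow_in S f & forall v, v \in S -> outflow f v = g v.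
Proof.
move=> gC; pose r := fingraph.root (adj_in S).
have /fin_all_exists[F FP] v : exists f, v \in S -> flow_in S f /\
    forall u, outflow f u = (u == v)%:R - (u == r v)%:R.
  have [vS|] := boolP (v \in S); last by exists 0.
  by have [f] := path_flow vS (connect_root _ v); exists f.
exists (\sum_(v in S) g v *: F v) => [|u uS].
  apply: big_ind => [|f f'|v vS]; [exact: flow_in0 | exact: flow_inD |].
  by apply: flow_inZ; case: (FP v vS).
have -> : outflow (\sum_(v in S) g v *: F v) u
    = \sum_(v in S) g v * ((u == v)%:R - (u == r v)%:R).
  rewrite (big_morph (fun f => outflow f u) (id1 := 0) (op1 := +%R)); first last.
  - exact: outflow0.
  - by move=> f f'; rewrite outflowD.
  by apply: eq_bigr => v vS; rewrite outflowZ; case: (FP v vS) => _ ->.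
(* The term at [u] gives [g u]; what is left, the demand sent to [u] as a root,
   is the total demand of a component or an empty sum. *)
under eq_bigr do rewrite mulrBr.
rewrite sumrB (bigD1 u) //= eqxx mulr1 big1 => [|v /andP[_]]; last first.
  by rewrite eq_sym => /negPf ->; rewrite mulr0.
rewrite addr0; apply/eqP; rewrite addrC -subr_eq0 addrK oppr_eq0; apply/eqP.
under eq_bigr do rewrite mulr_natr mulrb.
rewrite -big_mkcondr /=; have [ru|/eqP ru] := eqVneq (r u) u.
  rewrite -[RHS](gC [set y in S | connect (adj_in S) u y]); last first.
    by apply/componentP; exists u.
  apply: eq_bigl => v; rewrite inE -(root_connect (connect_adj_sym S)).
  by rewrite -/(r u) -/(r v) ru.
rewrite big_pred0 // => v; apply/andP => -[_ /eqP uE]; case: ru.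
by rewrite uE /r (root_root (connect_adj_sym S)).
Qed.

End Flows.

(** * The residue space is the initial space of the circulations *)

Section InitialSpaces.
Variables (k : fieldType) (G : mgraph).
Implicit Types (a : arrow G) (I : {set vertex G}) (u z w : Upsilon k G).
Implicit Types (p : opart (vertex G)) (W : {vspace Upsilon k G}).

Lemma thetaE I w a : theta k I w a = if tail a \in I then w a else 0.
Proof. by rewrite lfunE ffunE. Qed.

Lemma memUpsilon_initial p n w : reflect
  (forall a, (n <= level p (tail a))%N -> w a = 0) (w \in UpsilonI k (initial p n)).
Proof.
apply: (iffP (memUpsilonI _ _)) => w0 a h; apply: w0; move: h;
  by rewrite mem_initial -leqNgt.
Qed.

(** The summands of an initial space live on different levels, so membership can
    be tested on one level at a time. *)
Lemma mem_initial_space p W u :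
  u \in initial_space p W <-> forall n : 'I_(size (parts p)), exists w,
    [/\ w \in W, w \in UpsilonI k (initial p n.+1)
      & forall a, level p (tail a) = n -> w a = u a].
Proof.
split=> [/memv_sumP[us usP ->] n|H].
  have {usP} /fin_all_exists2[w wW wE] (m : 'I_(size (parts p))) : exists2 w,
      w \in supported_sub W (initial p m.+1) & us m = theta k (part p m) w.
    by have /memv_imgP := usP m isT.
  have := wW n; rewrite memv_cap => /andP[wnW wnS]; exists (w n); split=> // a an.
  rewrite sum_ffunE (bigD1 n) //= wE thetaE mem_part an eqxx big1 ?addr0 // => m.
  by rewrite wE thetaE mem_part an eq_sym => /negPf ->.
have /fin_all_exists[w wP] := H.
have -> : u = \sum_(n < size (parts p)) theta k (part p n) (w n).
  apply/ffunP => a.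
  have [l al] : exists l, level p (tail a) = l by exists (level p (tail a)).
  rewrite sum_ffunE (bigD1 l) //= big1 => [|m].
    by rewrite addr0 thetaE mem_part al eqxx; case: (wP l) => _ _ ->.
  by rewrite thetaE mem_part al eq_sym => /negPf ->.
apply: memv_sumr => n _; apply: memv_img; rewrite memv_cap.
by case: (wP n) => -> ->.
Qed.

Section ResidueSpaces.
Variable p : opart (vertex G).
Local Notation h := (level p).

(** For the condition on components: a circulation [z] that vanishes above level
    [n] sends nothing in total out of a component [Xi] of the levels
    below [n]; arrows inside [Xi] cancel, arrows to other vertices below [n] do
    not exist, and [z] vanishes on arrows to levels above [n], so the flux
    between [Xi] and level [n] is zero. *)
Lemma initial_circulation_residue u :
  u \in initial_space p (circulation_space k G) -> u \in residue_space k p.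
Proof.
move/mem_initial_space=> H; apply/mem_residue_space.
have {}H (n : 'I_(size (parts p))) : exists z, [/\ circulation z,
    forall a, (n < h (tail a))%N -> z a = 0 & forall a, h (tail a) = n -> z a = u a].
  by have [z [/mem_circulation_space zC /memUpsilon_initial zS zu]] := H n; exists z.
split=> [a|v|a /eqP|n Xi XiP].
- have [z [[anti _] z0 zu]] := H (h (tail a)); rewrite /downward => da.
  by have := anti a; rewrite [z (bar a)]z0 ?tail_bar // addr0 zu.
- have [z [[_ div] _ zu]] := H (h v); apply: etrans (div v).
  by apply: eq_bigr => a /eqP av; rewrite zu ?av.
- move=> ha; have [z [[anti _] _ zu]] := H (h (tail a)).
  by rewrite -!zu ?tail_bar ?anti.
have [z [[anti div] z0 zu]] := H n.
have -> : \sum_(a | [&& upward p a, h (tail a) == n & head a \in Xi]) u a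
    = flux z (part p n) Xi.
  apply: eq_big => [a|a /and3P[_ /eqP an _]]; last by rewrite zu.
  rewrite mem_part andbC -andbA; apply: andb_id2l => /eqP an.
  case: (boolP (head a \in Xi)) => //= aXi; rewrite /upward an.
  by have /subsetP/(_ _ aXi) := component_sub XiP; rewrite inE.
rewrite flux_bar //; apply/eqP; rewrite oppr_eq0 -(flux_out Xi div).
rewrite (flux_partition z Xi setT Xi) setTI flux_self // add0r.
rewrite (flux_partition z Xi (setT :\: Xi) (part p n)) [X in _ + X]flux_eq0 ?addr0.
  apply/eqP; congr flux; apply/setP=> v; rewrite in_setI in_setD in_setT andbT.
  case: (boolP (v \in part p n)) => [|_]; last by rewrite andbF.
  rewrite andbT mem_part => /eqP vn.
  suff -> : v \notin Xi by [].
  by apply/negP => /(subsetP (component_sub XiP)); rewrite inE vn ltnn.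
move=> a aXi; rewrite !inE mem_part andbT => /andP[ne nXi].
have /eqP := anti a; rewrite [z (bar a)]z0 ?addr0; first by move/eqP.
rewrite tail_bar ltn_neqAle eq_sym (inj_eq val_inj) ne leqNgt.
by apply: contra nXi => lt; apply: component_closed XiP aXi _; rewrite inE.
Qed.

(** The level [n] part of [u] is completed to a circulation: its upward arrows
    are matched by their reverses, and what they bring to the vertices below
    level [n] is carried away by a flow [f] there, which exists
    because the total brought to each component is zero. *)
Lemma residue_initial_circulation u :
  u \in residue_space k p -> u \in initial_space p (circulation_space k G).
Proof.
move/mem_residue_space=> [R1 R2 R3 R4]; apply/mem_initial_space => n.
pose S := [set v | (h v < n)%N].
pose g v : k := \sum_(a | (h (tail a) == n) && (head a == v)) u a.
have [|f [fanti fS] fg] := @flow_exists k G S g.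
  move=> C CP; apply: etrans (R4 n C CP).
  rewrite (partition_big (@head G) (fun v => v \in C)) /=; last by move=> a /and3P[].
  apply: eq_bigr => v vC; apply: eq_bigl => a; rewrite /upward.
  case: (h (tail a) =P n) => [an|]; last by rewrite !andbF.
  case: (head a =P v) => [->|]; last by rewrite !andbF.
  by have /subsetP/(_ _ vC) := component_sub CP; rewrite inE vC an => ->.
have f0 a : (n <= h (tail a))%N -> f a = 0.
  move=> le; apply/eqP; apply: contraLR le => /fS[].
  by rewrite inE -ltnNge.
(* The last term makes [z] skew between level [n] and the lower levels, and [f]
   compensates for the outflow which that creates at the lower vertices. *)
pose z : Upsilon k G := [ffun a =>
  f a + ((if h (tail a) == n :> nat then u a else 0)
    - (if (h (tail a) < n)%N && (h (head a) == n :> nat) then u (bar a) else 0))].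
have z0 a : (n < h (tail a))%N -> z a = 0.
  move=> lt.
  by rewrite ffunE (f0 _ (ltnW lt)) (gtn_eqF lt) ltnNge (ltnW lt) subrr addr0.
have zu a : h (tail a) = n -> z a = u a.
  by move=> an; rewrite ffunE f0 an // eqxx ltnn subr0 add0r.
exists z; split; last by [].
- apply/mem_circulation_space; split=> [a|v].
    rewrite !ffunE addrACA fanti add0r !tail_bar !head_bar barK.
    case: (ltngtP (h (tail a)) n) => ha; case: (ltngtP (h (head a)) n) => hb;
      rewrite /= ?subr0 ?sub0r ?addr0 ?add0r ?addNr ?addrN //.
    + by apply: R1; rewrite /downward tail_bar head_bar hb.
    + by apply: R1; rewrite /downward ha.
    + by apply: R3; apply/eqP/val_inj; exact: etrans ha (esym hb).
  have [vn|vn|/val_inj vn] := ltngtP (h v) n; last first.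
  - by apply: etrans (R2 v); apply: eq_bigr => a /eqP av; rewrite zu ?av.
  - by rewrite big1 // => a /eqP av; rewrite z0 ?av.
  under eq_bigr => a /eqP av do rewrite ffunE av (ltn_eqF vn) vn /= sub0r.
  rewrite sumrB -/(outflow f v) fg ?inE // /g; apply/eqP; rewrite subr_eq0; apply/eqP.
  rewrite -big_mkcondr /= (reindex_inj (inv_inj (@barK G))) /=; apply: eq_big => a.
    by rewrite tail_bar head_bar andbC.
  by [].
- by apply/memUpsilon_initial.
Qed.

End ResidueSpaces.

Lemma residue_spaceE p : residue_space k p = initial_space p (circulation_space k G).
Proof.
apply/vspaceP => u; apply/idP/idP; first exact: residue_initial_circulation.
exact: initial_circulation_residue.
Qed.

(** Let [w] in [W(p')] be a witness for level [n] of [p].  The element of [W]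
    with which [w] agrees on the level of [p'] containing level [n] is a witness
    in [W]: it vanishes above [n] because [w] does.  In the other direction, a
    witness in [W] is replaced by its restriction to that level of [p']. *)
Lemma initial_space_trans p p' W : coarsening p' p ->
  initial_space p (initial_space p' W) = initial_space p W.
Proof.
move=> [c [cmono cE]]; apply/vspaceP => u; apply/idP/idP => /mem_initial_space H;
  apply/mem_initial_space => n.
  have [w [/mem_initial_space/(_ (c n))[z [zW /memUpsilon_initial z0 zw]]]] := H n.
  move=> /memUpsilon_initial w0 wu.
  exists z; split=> // [|a an]; last by rewrite zw ?wu // cE an.
  apply/memUpsilon_initial => a an.
  have := cmono n (level p (tail a)) (ltnW an); rewrite -cE leq_eqVlt.
  case/orP=> [/eqP/val_inj e|]; last exact: z0.
  by rewrite zw // w0.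
have [z [zW zS zu]] := H n; have /memUpsilon_initial z0 := zS.
exists (theta k (part p' (c n)) z); split=> [||a an].
- apply/mem_initial_space => m; have [->|ne] := eqVneq m (c n).
    exists z; split=> // [|a am]; last by rewrite thetaE mem_part am eqxx.
    apply/memUpsilon_initial => a; rewrite cE => lt; apply: z0.
    by rewrite ltnNge; apply: contraL lt => /cmono; rewrite -leqNgt.
  exists 0; split; rewrite ?mem0v // => a am.
  by rewrite thetaE mem_part am (negPf ne) ffunE.
- apply/memUpsilon_initial => a an.
  by rewrite thetaE (z0 _ an) if_same.
- by rewrite thetaE mem_part cE an eqxx zu.
Qed.

Lemma initial_space_residue p p' : coarsening p' p ->
  residue_space k p = initial_space p (residue_space k p').
Proof. by move=> c; rewrite !residue_spaceE initial_space_trans. Qed.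

End InitialSpaces.

(** * The limit of a subspace under a one-parameter torus *)

(** By induction on [r], extending a projector from [X r] to [X r.+1]: on [X r]
    keep it, on a complement of [W :&: X r] in [W :&: X r.+1] take the identity,
    and kill a complement of the sum of the two. *)
Lemma adapted_projector (k : fieldType) (vT : vectType k)
    (W : {vspace vT}) (X : nat -> {vspace vT}) r :
  (forall n, (X n <= X n.+1)%VS) -> X 0%N = 0%VS ->
  exists P : 'End(vT),
    [/\ forall n v, (n <= r)%N -> v \in X n -> P v \in (W :&: X n)%VS
      & forall v, v \in (W :&: X r)%VS -> P v = v].
Proof.
move=> Xmono X0; have Xle m n : (m <= n)%N -> (X m <= X n)%VS.
  move/subnK <-; elim: (n - m)%N => [|i IH] //; exact: subv_trans IH (Xmono _).
elim: r => [|r [P [PX PW]]].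
  exists 0%VF; split=> [n v _ _|v]; first by rewrite lfunE /= mem0v.
  by rewrite X0 capv0 memv0 => /eqP ->; rewrite linear0.
pose U := (W :&: X r.+1)%VS; pose p1 := addv_pi1 U (X r); pose p2 := addv_pi2 U (X r).
pose Q : 'End(vT) := ((p1 + (P \o p2)) \o projv (U + X r))%VF; exists Q.
have QE' (v : vT) : Q v = p1 (projv (U + X r) v) + P (p2 (projv (U + X r) v)).
  by rewrite comp_lfunE add_lfunE comp_lfunE.
have QE (v : vT) : v \in (U + X r)%VS -> Q v = p1 v + P (p2 v).
  by move=> vU; rewrite QE' projv_id.
have split (v : vT) : v \in (U + X r)%VS -> p1 v + p2 v = v by exact: addv_pi1_pi2.
have QW (w : vT) : w \in U -> Q w = w.
  move=> wU; have wS : w \in (U + X r)%VS by rewrite (subvP (addvSl _ _)).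
  rewrite QE // PW ?split // memv_cap memv_pi2 andbT.
  have /(canRL (addKr _)) -> := split w wS; rewrite addrC rpredB //.
    by move: wU; rewrite memv_cap => /andP[].
  by have := memv_pi1 U (X r) w; rewrite memv_cap => /andP[].
split=> // n v; rewrite leq_eqVlt => /predU1P[->|lt] vX.
  rewrite QE' rpredD ?memv_pi1 //.
  have := PX r _ (leqnn r) (memv_pi2 U (X r) (projv (U + X r) v)).
  exact/subvP/capvS.
have vXr : v \in X r by apply: (subvP (Xle n r lt)).
have vS : v \in (U + X r)%VS by rewrite (subvP (addvSr _ _)).
have p2v : p2 v = v by exact: addv_pi2_id.
have /eqP := split v vS; rewrite p2v -subr_eq0 addrK => /eqP p10.
by rewrite QE // p10 add0r p2v; apply: PX.
Qed.

Section Limit.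
Variables (k : fieldType) (G : mgraph).
Implicit Types (a b : arrow G) (u w : Upsilon k G).
Local Notation "x %:F" := (@FracField.tofrac _ x).
Local Notation kt := {fraction {poly k}}.
Local Notation UpsilonF := {ffun arrow G -> kt}.
Local Notation UpsilonP := {ffun arrow G -> {poly k}}.
Local Notation t := (tvar k).

Lemma laurent_poly (f : {poly k}) : laurent f%:F.
Proof. by exists f, 0%N; rewrite expr0 divr1. Qed.

Lemma laurentM (q r : kt) : laurent q -> laurent r -> laurent (q * r).
Proof.
move=> [f [m ->]] [g [n ->]]; exists (f * g), (m + n)%N.
by rewrite tofracM exprD invfM mulrACA.
Qed.

Lemma laurentD (q r : kt) : laurent q -> laurent r -> laurent (q + r).
Proof.
move=> [f [m ->]] [g [n ->]]; exists (f * 'X^n + g * 'X^m), (m + n)%N.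
by rewrite tofracD !tofracM !tofracXn -/(tvar k) exprD addf_div ?expf_neq0 ?tvar_neq0.
Qed.

Lemma laurent_tvarz (z : int) : laurent (t ^ z).
Proof.
case: z => n.
  by rewrite -exprnP -tofracXn; apply: laurent_poly.
by exists 1, n.+1; rewrite NegzE -exprnN tofrac1 div1r.
Qed.

(** If the columns of [M] lie in [S] and [M] fixes [S], then [M] is idempotent and
    the Laurent span of [S] is its image on Laurent vectors; a fixed vector is
    the combination of the columns with its own coordinates as coefficients. *)
Lemma Rspan_fixed (S : UpsilonF -> Prop) (M : arrow G -> arrow G -> kt) phi :
  (forall b, S [ffun a => M a b]) ->
  (forall f, S f -> (forall a, laurent (f a)) /\
                    forall a, f a = \sum_b M a b * f b) ->
  Rspan S phi <->
  (forall a, laurent (phi a)) /\ forall a, phi a = \sum_b M a b * phi b.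
Proof.
move=> SM SP; split=> [[s [sS phiE]]|[phiL phiM]].
  split=> a; rewrite phiE.
    rewrite big_seq; apply: big_ind => [||c /sS[cL /SP[fL _]]].
    - by rewrite -tofrac0; apply: laurent_poly.
    - exact: laurentD.
    - exact: laurentM.
  under [RHS]eq_bigr do rewrite phiE mulr_sumr.
  rewrite exchange_big /= !big_seq; apply: eq_bigr => c /sS[_ /SP[_ ->]].
  by rewrite mulr_sumr; apply: eq_bigr => b _; rewrite mulrCA.
exists [seq (phi b, [ffun a => M a b]) | b <- enum {: arrow G}]; split.
  by move=> _ /mapP[b _ ->] /=.
move=> a; rewrite phiM big_map big_enum /=.
by apply: eq_bigr => b _; rewrite ffunE mulrC.
Qed.

Definition unit_vec b : Upsilon k G := [ffun a => (a == b)%:R].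

Section Projector.
Variables (d : vertex G -> int) (W : {vspace Upsilon k G}) (P : 'End(Upsilon k G)).
Hypothesis PW : forall v, P v \in W.
Hypothesis P_id : forall w, w \in W -> P w = w.
Local Notation entry a b := (P (unit_vec b) a).
Hypothesis P_graded : forall a b, entry a b != 0 -> d (tail a) <= d (tail b).

Lemma entryE v a : P v a = \sum_b entry a b * v b.
Proof.
have {1}-> : v = \sum_b v b *: unit_vec b.
  apply/ffunP => c; rewrite sum_ffunE (bigD1 c) //= big1 => [|b].
    by rewrite !ffunE eqxx addr0 [RHS]mulr1.
  by rewrite !ffunE eq_sym => /negPf ->; rewrite scaler0.
rewrite linear_sum sum_ffunE; apply: eq_bigr => b _.
by rewrite linearZ ffunE mulrC.
Qed.

Lemma entry_idem a c : entry a c = \sum_b entry a b * entry b c.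
Proof. by rewrite -entryE (P_id (PW _)). Qed.

(** The entries of the conjugate of [P] by the action of [x].  By [P_graded] the
    exponent is nonnegative wherever the entry of [P] is nonzero, so the
    absolute value changes nothing ([twistE]). *)
Definition twist a b : {poly k} :=
  (entry a b)%:P * 'X^(`|d (tail b) - d (tail a)|%N).

Lemma twistE a b :
  (twist a b)%:F = t ^ (d (tail b) - d (tail a)) * (entry a b)%:P%:F.
Proof.
rewrite /twist tofracM mulrC tofracXn; have [->|/P_graded le] := eqVneq (entry a b) 0.
  by rewrite polyC0 tofrac0 !mulr0.
by rewrite exprnP gez0_abs ?subr_ge0.
Qed.

Lemma twist_idem a c : twist a c = \sum_b twist a b * twist b c.
Proof.
apply/eqP; rewrite -tofrac_eq twistE entry_idem; apply/eqP.
rewrite !rmorph_sum /= mulr_sumr; apply: eq_bigr => b _.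
rewrite tofracM !twistE polyCM tofracM mulrACA -expfzDr ?tvar_neq0 //.
by rewrite [_ - d (tail a) + _]addrC subrKA.
Qed.

Definition twist_act (f : UpsilonP) : UpsilonP :=
  [ffun a => \sum_b twist a b * f b].

Lemma twist_actD f g : twist_act (f + g) = twist_act f + twist_act g.
Proof.
apply/ffunP => a; rewrite !ffunE -big_split; apply: eq_bigr => b _.
by rewrite ffunE mulrDr.
Qed.

Lemma twist_actZ (c : {poly k}) (f : UpsilonP) :
  twist_act [ffun a => c * f a] = [ffun a => c * twist_act f a].
Proof.
apply/ffunP => a; rewrite !ffunE mulr_sumr; apply: eq_bigr => b _.
by rewrite ffunE mulrCA.
Qed.

Lemma twist_act0 : twist_act 0 = 0.
Proof.
by apply/ffunP => a; rewrite !ffunE big1 // => b _; rewrite ffunE mulr0.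
Qed.

Lemma twist_act_idem f : twist_act (twist_act f) = twist_act f.
Proof.
apply/ffunP => a; rewrite !ffunE; under eq_bigr do rewrite ffunE mulr_sumr.
rewrite exchange_big; apply: eq_bigr => c _; rewrite [in RHS]twist_idem mulr_suml.
by apply: eq_bigr => b _; rewrite mulrA.
Qed.

Lemma mem_family psi : family d W psi <->
  (forall a, laurent (psi a)) /\
  forall a, psi a = \sum_b (twist a b)%:F * psi b.
Proof.
have t0 := tvar_neq0 k.
have ext := @Rspan_fixed (fun phi => exists2 w, w \in W & phi = const_embed w)
  (fun a b => (entry a b)%:P%:F).
have {}ext phi : extend_scalars W phi <-> (forall a, laurent (phi a)) /\
    forall a, phi a = \sum_b (entry a b)%:P%:F * phi b.
  apply: ext => [b|_ [w wW ->]].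
    by exists (P (unit_vec b)).
  split=> a; rewrite ffunE; first exact: laurent_poly.
  rewrite -{1}(P_id wW) entryE rmorph_sum rmorph_sum /=; apply: eq_bigr => b _.
  by rewrite ffunE polyCM tofracM.
split=> [[phi /ext[phiL phiM] ->]|[psiL psiM]].
  split=> a; rewrite ffunE; first exact: laurentM (laurent_tvarz _) (phiL a).
  rewrite phiM mulr_sumr; apply: eq_bigr => b _.
  rewrite twistE ffunE mulrACA -expfzDr //.
  by rewrite addrAC subrr add0r.
exists [ffun a => t ^ d (tail a) * psi a]; last first.
  by apply/ffunP => a; rewrite !ffunE mulrA -expfzDr // addNr expr0z mul1r.
apply/ext; split=> a; rewrite ffunE; first exact: laurentM (laurent_tvarz _) (psiL a).
rewrite psiM mulr_sumr; apply: eq_bigr => b _.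
rewrite twistE ffunE !mulrA -expfzDr // addrCA subrr addr0.
by rewrite [_ * t ^ _]mulrC.
Qed.

Lemma at0_twist_act f a : at0 (twist_act f) a =
  \sum_(b | d (tail b) == d (tail a)) entry a b * (f b).[0].
Proof.
rewrite !ffunE horner_sum [RHS]big_mkcond; apply: eq_bigr => b _.
rewrite /twist !hornerE expr0n absz_eq0 subr_eq0.
by case: ifP; rewrite ?mulr1 // mulr0 mul0r.
Qed.

(** The extension of the family to the affine line is the image of the
    idempotent [twist_act], with the kernel as its complement. *)
Lemma limit_adapted_projector (U : {vspace Upsilon k G}) :
  (forall u, u \in U <->
     forall a, u a = \sum_(b | d (tail b) == d (tail a)) entry a b * u b) ->
  is_limit d W U.
Proof.
move=> UE; exists (fun f => twist_act f = f); split.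
- split.
    split=> [|f g fE gE|c f fE]; first exact: twist_act0.
      by rewrite twist_actD fE gE.
    by rewrite twist_actZ fE.
  exists (fun f => twist_act f = 0); split=> [|f|f fE f0].
  + split=> [|f g fE gE|c f fE]; first exact: twist_act0.
      by rewrite twist_actD fE gE addr0.
    by rewrite twist_actZ fE; apply/ffunP => a; rewrite !ffunE mulr0.
  + exists (twist_act f), (f - twist_act f); split; first exact: twist_act_idem.
      apply: (addrI (twist_act f)); rewrite -{1}twist_act_idem -twist_actD.
      by rewrite addrC subrK addr0.
    by rewrite addrC subrK.
  + by rewrite -fE f0.
- move=> phi; apply: iff_trans (iff_sym (mem_family phi)).
  apply: Rspan_fixed => [b|_ [f fE ->]].
    exists [ffun a => twist a b]; last by apply/ffunP => a; rewrite !ffunE.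
    apply/ffunP => a; rewrite !ffunE [RHS]twist_idem.
    by apply: eq_bigr => c _; rewrite ffunE.
  split=> a; rewrite ffunE; first exact: laurent_poly.
  rewrite -{1}fE ffunE rmorph_sum; apply: eq_bigr => b _.
  by rewrite rmorphM ffunE.
move=> u; split=> [/UE uE|[f fE ->]].
  exists (twist_act [ffun a => (u a)%:P]); first exact: twist_act_idem.
  apply/ffunP => a; rewrite at0_twist_act uE; apply: eq_bigr => b _.
  by rewrite ffunE hornerC.
apply/UE => a; rewrite -{1}fE at0_twist_act; apply: eq_bigr => b _.
by rewrite ffunE.
Qed.
End Projector.

Lemma level_induced (d : vertex G -> int) x y :
  (level (induced_opart d) x <= level (induced_opart d) y)%N = (d x <= d y).
Proof.
pose s := sort <=%O (undup (codom d)).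
have ds v : d v \in s by rewrite mem_sort mem_undup codom_f.
have levelE v : level (induced_opart d) v = index (d v) s :> nat.
  rewrite /= find_map; apply: eq_find => z /=; by rewrite inE eq_sym.
have le (v v' : vertex G) : (index (d v) s <= index (d v') s)%N -> d v <= d v'.
  by apply: (sorted_leq_index le_trans lexx (sort_le_sorted _)).
rewrite !levelE; apply/idP/idP => [/le //|dxy]; rewrite leqNgt; apply/negP => lt.
have e : d x = d y by apply/eqP; rewrite eq_le dxy le // ltnW.
by rewrite e ltnn in lt.
Qed.

(** At [t = 0] only the entries of [P] within a level remain.  On an element of
    [W] that vanishes above level [n], lower levels do not contribute to level
    [n] of its image under [P], which is the element itself; hence these entries
    fix exactly the initial space. *)
Lemma is_limit_initial_space (d : vertex G -> int) (W : {vspace Upsilon k G}) :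
  is_limit d W (initial_space (induced_opart d) W).
Proof.
set p := induced_opart d; pose X n := UpsilonI k (initial p n).
have Xmono n : (X n <= X n.+1)%VS.
  apply/subvP => w /memUpsilon_initial w0; apply/memUpsilon_initial => a an.
  exact: w0 (ltnW an).
have X0 : X 0%N = 0%VS.
  apply/eqP; rewrite -subv0; apply/subvP => w /memUpsilon_initial w0.
  by rewrite memv0; apply/eqP/ffunP => a; rewrite w0 ?ffunE.
have XT w : w \in X (size (parts p)).
  by apply/memUpsilon_initial => a; rewrite leqNgt ltn_ord.
have [P [PX P_id]] := adapted_projector W (size (parts p)) Xmono X0.
have {}P_id w : w \in W -> P w = w by move=> wW; rewrite P_id // memv_cap wW XT.
have PX1 n w : (n <= size (parts p))%N -> w \in X n -> P w \in W /\ P w \in X n.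
  by move=> le /(PX n w le); rewrite memv_cap => /andP.
have PW w : P w \in W by case: (PX1 _ w (leqnn _) (XT w)).
have sameE a b : (d (tail b) == d (tail a)) = (level p (tail b) == level p (tail a)).
  by rewrite eq_le -!level_induced -/p -eqn_leq.
have entry0 a b : (level p (tail b) < level p (tail a))%N -> P (unit_vec b) a = 0.
  move=> lt.
  have [|_ /memUpsilon_initial] := PX1 (level p (tail b)).+1 (unit_vec b) (ltn_ord _).
    apply/memUpsilon_initial => c cb; rewrite ffunE.
    by case: eqP => // cE; rewrite cE ltnn in cb.
  exact.
apply: (limit_adapted_projector PW P_id) => [a b|u].
  by apply: contraNT; rewrite -level_induced -ltnNge => /entry0 ->.
split=> [/mem_initial_space H a|H].
  have [w [wW /memUpsilon_initial w0 wu]] := H (level p (tail a)).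
  rewrite -wu // -{1}(P_id w wW) entryE.
  rewrite (bigID (fun b => level p (tail b) == level p (tail a))) /=.
  rewrite [X in _ + X]big1 ?addr0 => [|b ne].
    by apply: eq_big => [b|b /eqP bE]; rewrite ?sameE // wu.
  have [lt|lt|/val_inj e] := ltngtP (level p (tail b)) (level p (tail a)).
  - by rewrite entry0 ?mul0r.
  - by rewrite w0 ?mulr0.
  - by rewrite e eqxx in ne.
apply/mem_initial_space => n; exists (P (theta k (part p n) u)).
have [|PuW PuX] := PX1 n.+1 (theta k (part p n) u) (ltn_ord _).
  apply/memUpsilon_initial => a an; rewrite thetaE mem_part.
  by case: eqP => // aE; rewrite aE ltnn in an.
split=> // a an; rewrite H entryE [RHS]big_mkcond; apply: eq_bigr => b _.
rewrite thetaE mem_part sameE an.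
by case: ifP; rewrite ?mulr0.
Qed.
End Limit.

(** * Dimensions of projections of initial spaces *)

Section Dimensions.
Variables (k : fieldType) (G : mgraph).
Implicit Types (a : arrow G) (I J : {set vertex G}) (u z w : Upsilon k G).
Implicit Types (p : opart (vertex G)) (W : {vspace Upsilon k G}).

Lemma theta_comp I J W :
  (theta k I @: (theta k J @: W) = theta k (I :&: J) @: W)%VS.
Proof.
rewrite -limg_comp; congr lfun_img; apply/lfunP => w; apply/ffunP => a.
by rewrite comp_lfunE !thetaE inE; case: (tail a \in I).
Qed.

Lemma supported_subT W : supported_sub W [set: vertex G] = W.
Proof.
by apply/capv_idPl/subvP => w _; apply/memUpsilonI => a; rewrite inE.
Qed.

Lemma supported_sub0 W : supported_sub W set0 = 0%VS.
Proof.
apply/eqP; rewrite -subv0; apply/subvP => w; rewrite memv_cap memv0.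
by case/andP=> _ /memUpsilonI w0; apply/eqP/ffunP => a; rewrite w0 ?inE ?ffunE.
Qed.

(** Rank-nullity for [theta k I] on the elements of [W] supported on [J]. *)
Lemma dim_theta_supported W I J :
  (\dim (theta k I @: supported_sub W J) + \dim (supported_sub W (J :\: I))
   = \dim (supported_sub W J))%N.
Proof.
rewrite -[RHS](limg_ker_dim (theta k I)) addnC; congr (\dim _ + _)%N.
apply/vspaceP => w; rewrite !memv_cap -andbA; congr (_ && _).
apply/memUpsilonI/andP => [w0|[/memUpsilonI w0]].
  split; first by apply/memUpsilonI => a aJ; rewrite w0 // inE negb_and aJ orbT.
  rewrite memv_ker; apply/eqP/ffunP => a; rewrite thetaE ffunE.
  by case: ifP => // aI; rewrite w0 // inE aI.
rewrite memv_ker => /eqP/ffunP wI a; rewrite inE negb_and negbK.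
by case/orP => [aI|/w0 //]; have := wI a; rewrite thetaE aI ffunE.
Qed.

Lemma dim_theta_initial p W I :
  \dim (theta k I @: initial_space p W) = (\sum_(n < size (parts p))
    \dim (theta k (I :&: part p n) @: supported_sub W (initial p n.+1)))%N.
Proof.
rewrite limg_sum; under eq_bigr do rewrite theta_comp.
apply/directvP/directv_sum_independent => us usP us0 n _.
have us_part (m : 'I_(size (parts p))) a : level p (tail a) != m -> us m a = 0.
  have /memv_imgP[w _ ->] := usP m isT; rewrite thetaE inE mem_part => /negPf ->.
  by rewrite andbF.
apply/ffunP => a; rewrite ffunE; have [an|/us_part //] := eqVneq (level p (tail a)) n.
have := congr1 (fun f : Upsilon k G => f a) us0.
rewrite sum_ffunE (bigD1 n) //= big1 ?addr0 => [|m ne]; first by move->; rewrite ffunE.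
by rewrite us_part // an eq_sym.
Qed.

Lemma initial_setD p I (n : 'I_(size (parts p))) :
  initial p n.+1 :\: (I :&: part p n) = (~: I :&: initial p n.+1) :|: initial p n.
Proof.
apply/setP => v; rewrite !inE !mem_initial mem_part ltnS.
rewrite (_ : (level p v == n) = (level p v == n :> nat)) //.
by case: (v \in I); case: (ltngtP (level p v) n).
Qed.

(** The adjoint of the rank function of [W] is [J |-> dim W^J], so that both sides
    are sums over the levels, and rank-nullity compares them termwise. *)
Lemma dim_theta_initial_splitting p W I :
  (\dim (theta k I @: initial_space p W))%:Z =
  splitting_sub p (fun J => (\dim (theta k J @: W))%:Z) I.
Proof.
have adjE J : adjoint (fun J => (\dim (theta k J @: W))%:Z) J
    = (\dim (supported_sub W J))%:Z.
  rewrite /adjoint; have := dim_theta_supported W (~: J) setT.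
  have := dim_theta_supported W setT setT.
  rewrite supported_subT !setTD setCK setCT.
  by rewrite supported_sub0 dimv0 addn0 => -> <-; rewrite PoszD addrC addKr.
rewrite dim_theta_initial /splitting_sub {1}/adjoint /splitting_super -sumrB.
rewrite (big_morph Posz PoszD (erefl _)); apply: eq_bigr => n _.
rewrite !adjE setTI opprB addrA subrK -initial_setD.
have /setUidPl -> : initial p n \subset initial p n.+1.
  by apply/subsetP => v; rewrite !mem_initial; apply: ltnW.
by rewrite -(dim_theta_supported W (I :&: part p n)) PoszD addrK.
Qed.

Lemma dim_initial_space p W : \dim (initial_space p W) = \dim W.
Proof.
have thetaT U : (theta k [set: vertex G] @: U = U)%VS.
  rewrite -[RHS]lim1g; congr lfun_img; apply/lfunP => w.
  by apply/ffunP=> a; rewrite thetaE inE id_lfunE.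
pose s n := (\dim (supported_sub W (initial p n)))%:Z.
have s0 : s 0%N = 0.
  rewrite /s (_ : initial p 0 = set0) ?supported_sub0 ?dimv0 //.
  by apply/setP => v; rewrite mem_initial inE.
have sT : s (size (parts p)) = \dim W.
  rewrite /s (_ : initial p _ = setT) ?supported_subT //.
  by apply/setP => v; rewrite mem_initial inE ltn_ord.
apply/eqP; rewrite -eqz_nat -[initial_space p W]thetaT dim_theta_initial.
rewrite -sT -[s (size _)]subr0 -s0 -telescope_sumr // big_mkord.
rewrite (big_morph Posz PoszD (erefl _)); apply/eqP/eq_bigr => n _.
rewrite /s -(dim_theta_supported W (setT :&: part p n)) initial_setD setCT set0I set0U.
by rewrite PoszD addrK.
Qed.

(** [theta k I] maps [W(p)] into the initial space of [theta k I @: W], which has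
    the dimension of [theta k I @: W]. *)
Lemma dim_theta_initial_le p W I :
  (\dim (theta k I @: initial_space p W) <= \dim (theta k I @: W))%N.
Proof.
rewrite -(dim_initial_space p (theta k I @: W)); apply: dimvS.
apply/subvP => _ /memv_imgP[u /mem_initial_space H ->]; apply/mem_initial_space => n.
have [w [wW /memUpsilon_initial w0 wu]] := H n.
exists (theta k I w); split; first exact: memv_img.
  by apply/memUpsilon_initial => a an; rewrite thetaE w0 ?if_same.
by move=> a an; rewrite !thetaE wu.
Qed.
End Dimensions.

Theorem theorem6p1 (k : fieldType) (G : mgraph) (hV : (0 < #|vertex G|)%N)
    (pi pi' : opart (vertex G)) (hcoarse : coarsening pi' pi)
    (d : vertex G -> int) (hd : induced_opart d = pi) :
  [/\ is_limit d (residue_space k pi') (residue_space k pi),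
      residue_space k pi = initial_space pi (residue_space k pi'),
      forall I : {set vertex G},
        gamma k pi I = splitting_sub pi (gamma k pi') I
    & forall I : {set vertex G}, (gamma k pi I <= gamma k pi' I)%R].
Proof.
have piE := initial_space_residue k hcoarse.
split=> [||I|I]; rewrite /gamma ?piE //.
- by rewrite -hd; apply: is_limit_initial_space.
- exact: dim_theta_initial_splitting.
- by rewrite lez_nat; apply: dim_theta_initial_le.
Qed.
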